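(* Let $n\in\mathbb{N}$ and let $a=(a_k)_{k\in\mathbb{Z}}$ be a biinfinite $(n+1)$-periodic sequence of real numbers, i.e. $a_k=a_{k+n+1}$ for every integer $k$. Let $A_a$ be the bounded operator on $\ell^2(\mathbb{Z})$ whose matrix has $(k,k+1)$ entry equal to $1$ and $(k+1,k)$ entry equal to $a_k$ for every $k\in\mathbb{Z}$, and all other entries equal to $0$. Suppose that $a_1=1$ and that the finite word $a_2a_3\cdots a_na_0$ is palindromic, i.e. $a_2a_3\cdots a_na_0=a_0a_n\cdots a_3a_2$. Then \[ \overline{W(A_a)}=\mathrm{conv}\left(W(A^+)\cup W(A^-)\right), \] where $A^{+}$ and $A^-$ are the $(n+1)\times(n+1)$ tridiagonal matrices \[ A^{\pm}=\begin{pmatrix} \pm 1 & 1 & 0 & \cdots & 0 & 0 & 0\\ a_2 & 0 & 1 & \cdots & 0 & 0 & 0\\ 0 & a_3 & 0 & \cdots & 0 & 0 & 0\\ \vdots & \vdots & \vdots & \ddots & \vdots & \vdots & \vdots\\ 0 & 0 & 0 & \cdots & 0 & 1 & 0\\ 0 & 0 & 0 & \cdots & a_n & 0 & 1\\ 0 & 0 & 0 & \cdots & 0 & a_0 & \pm 1 \end{pmatrix}. \] That is, with rows and columns indexed by $1,\dots,n+1$: the $(1,1)$ and $(n+1,n+1)$ entries are both $\pm1$ (same sign), all other diagonal entries are $0$; the $(j,j+1)$ entry is $1$ and the $(j+1,j)$ entry is $a_{j+1}$ for $1\le j\le n$ (where $a_{n+1}=a_0$); all other entries are $0$.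
   Context: $\mathbb{N}$ is the set of positive integers. For a bounded operator $A$ on a Hilbert space, $W(A)=\{\langle Ax,x\rangle : \|x\|=1\}\subset\mathbb{C}$ is its numerical range; finite square matrices act on $\mathbb{C}^m$ with the standard inner product. $\mathrm{conv}$ denotes convex hull in $\mathbb{C}$ and the bar denotes closure. For $n=1$ the word $a_2\cdots a_na_0$ is the single letter $a_0$, so the palindrome condition is vacuous. *)

(* Defs.v *)
(* The complex numbers are [R[i]] for an arbitrary [R : realType], written
   [R[i]^o] where their topology or vector space structure matters. *)
From HB Require Import structures.
From mathcomp Require Import all_boot all_order all_algebra.
From mathcomp Require Import all_classical all_reals all_analysis.
From mathcomp Require Import complex.
From mathcomp Require Import zify ring lra.

Set Implicit Arguments.
Unset Strict Implicit.
Unset Printing Implicit Defensive.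

Import Order.TTheory GRing.Theory Num.Theory numFieldNormedType.Exports.
Import Normc.

Local Open Scope classical_set_scope.
Local Open Scope ring_scope.

Definition numrange (C : numClosedFieldType) (V : Type) (ip : V -> V -> C)
    (T : V -> V) : set C^o :=
  [set ip (T x) x | x in [set x | sqrtC (ip x x) = 1]].

(* For [C = R[i]] the scalars [t : C] with [0 <= t <= 1] that define
   [convex_set] are exactly the reals between 0 and 1. *)
Definition conv_hull (C : numClosedFieldType) (A : set C^o) : set C^o :=
  smallest (@convex_set C C^o) A.

Section SquareSummable.
Variable R : realType.
Implicit Types (x y : int -> R[i]) (a : int -> R).

Definition sqnorm x : \bar R := \esum_(k in [set: int]) (normc (x k) ^+ 2)%:E.

Definition square_summable : {pred int -> R[i]} :=
  fun x => `[< (sqnorm x < +oo)%E >].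

Lemma normc_ge0 (z : R[i]) : 0 <= normc z.
Proof. by case: z => u v; exact: sqrtr_ge0. Qed.

Lemma normc_sqD (u v : R[i]) :
  normc (u + v) ^+ 2 <= (normc u ^+ 2 + normc v ^+ 2) *+ 2.
Proof.
have h : normc (u + v) <= normc u + normc v by exact: le_normcD.
apply: (@le_trans _ _ ((normc u + normc v) ^+ 2)).
  by rewrite ler_sqr ?nnegrE ?addr_ge0 ?normc_ge0.
rewrite -subr_ge0; set p := normc u; set q := normc v.
have -> : (p ^+ 2 + q ^+ 2) *+ 2 - (p + q) ^+ 2 = (p - q) ^+ 2.
  by rewrite sqrrB sqrrD mulr2n; lra.
exact: sqr_ge0.
Qed.

Lemma sqnormD x y :
  (sqnorm (fun k => (x k + y k)%R) <= (sqnorm x + sqnorm y) + (sqnorm x + sqnorm y))%E.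
Proof.
have p0 (z : int -> R[i]) k : [set: int] k -> (0 <= (normc (z k) ^+ 2)%:E)%E.
  by move=> _; rewrite lee_fin sqr_ge0.
have s0 k : [set: int] k ->
    (0 <= (normc (x k) ^+ 2)%:E + (normc (y k) ^+ 2)%:E)%E.
  by move=> kT; rewrite adde_ge0 ?p0.
rewrite /sqnorm -(esumD (p0 x) (p0 y)) -(esumD s0 s0).
apply: le_esum => k _.
by rewrite -!EFinD lee_fin -mulr2n; exact: normc_sqD.
Qed.

Lemma sqnormM (c : int -> R[i]) (M : R) x : (forall k, normc (c k) <= M) ->
  (sqnorm (fun k => (c k * x k)%R) <= (M ^+ 2)%:E * sqnorm x)%E.
Proof.
move=> cM; apply: ge_ereal_sup => _ [F [finF _] <-].
apply: (@le_trans _ _ ((M ^+ 2)%:E * \sum_(k \in F) (normc (x k) ^+ 2)%:E)%E).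
  rewrite ge0_mule_fsumr; last by move=> k; rewrite lee_fin sqr_ge0.
  rewrite lee_fsum// => k Fk; rewrite -EFinM lee_fin normcM exprMn.
  rewrite ler_wpM2r ?sqr_ge0// ler_sqr ?nnegrE ?normc_ge0//.
  exact: le_trans (normc_ge0 _) (cM 0).
rewrite lee_wpmul2l ?lee_fin ?sqr_ge0//.
by apply: ereal_sup_ubound; exists F.
Qed.

Lemma sqnorm_shift x m : sqnorm (fun k => x (k + m)) = sqnorm x.
Proof.
rewrite /sqnorm -(@reindex_esum _ _ _ [set: int] [set: int] (fun k => k + m)
  (fun k => (normc (x k) ^+ 2)%:E))//.
split=> //; first by move=> u v _ _ /addIr.
by move=> k _; exists (k - m); rewrite ?subrK.
Qed.

Lemma square_summable_submod : submod_closed square_summable.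
Proof.
have c0 : sqnorm (0 : int -> R[i]) = 0%E.
  by apply: esum1 => k _; rewrite (@normc0 R) expr0n.
split; first by apply/asboolP; rewrite c0 ltry.
move=> z x y /asboolP xoo /asboolP yoo; apply/asboolP.
apply: (le_lt_trans (sqnormD _ _)).
have zoo : (sqnorm (z *: x) < +oo)%E.
  apply: (@le_lt_trans _ _ ((normc z ^+ 2)%:E * sqnorm x)%E).
    exact: (@sqnormM (fun=> z)).
  by rewrite lte_mul_pinfty// lee_fin sqr_ge0.
by rewrite !lte_add_pinfty.
Qed.

HB.instance Definition _ :=
  GRing.isSubmodClosed.Build _ _ square_summable square_summable_submod.

Record ell2 := Ell2 {
  ell2_fun :> int -> R[i];
  ell2P : ell2_fun \in square_summable }.

HB.instance Definition _ := [isSub for ell2_fun].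
HB.instance Definition _ := [Choice of ell2 by <:].
HB.instance Definition _ := [SubChoice_isSubLmodule of ell2 by <:].

(* By Cauchy-Schwarz the two-sided series converges absolutely, so that
   symmetric partial sums (indices from -N to N) do compute its sum. *)
Definition ell2_ip (x y : ell2) : R[i] :=
  limn (fun N : nat =>
    \sum_(i < N.*2.+1) x (i%:Z - N%:Z) * Num.conj (y (i%:Z - N%:Z)) : R[i]^o).

Definition tridiag_entry a (j k : int) : R[i] :=
  if k == j + 1 then 1 else if j == k + 1 then real_complex R (a k) else 0.

(* Every row of the matrix has finite support, so this is a finite sum. *)
Definition tridiag_fun a x : int -> R[i] :=
  fun j => \sum_(k \in [set: int]) tridiag_entry a j k * x k.

Lemma tridiag_funE a x j :
  tridiag_fun a x j = x (j + 1) + real_complex R (a (j - 1)) * x (j - 1).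
Proof.
rewrite /tridiag_fun (fsbigE [:: j + 1; j - 1]).
- rewrite !big_cons big_nil /= !in_setT addr0 /tridiag_entry eqxx mul1r.
  by rewrite subrK eqxx ifF//; apply/eqP; lia.
- by rewrite /= inE andbT; apply/eqP; lia.
- by move=> k _.
- move=> k _; rewrite /tridiag_entry !inE => /norP[/eqP k1 /eqP k2].
  by rewrite !ifF ?mul0r//; apply/eqP => // jk; apply: k2; lia.
Qed.

(* Bounded entries give a bounded operator. *)
Lemma sqnorm_tridiag a M x : (forall k, `|a k| <= M) ->
  (sqnorm (tridiag_fun a x) <= (sqnorm x + (M ^+ 2)%:E * sqnorm x) +
                               (sqnorm x + (M ^+ 2)%:E * sqnorm x))%E.
Proof.
move=> aM; have -> : tridiag_fun a x =
    fun j => x (j + 1) + real_complex R (a (j - 1)) * x (j - 1).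
  by apply/funext => j; rewrite tridiag_funE.
apply: (le_trans (sqnormD _ _)).
have h : (sqnorm (fun j => real_complex R (a (j - 1)) * x (j - 1))%R <=
    (M ^+ 2)%:E * sqnorm x)%E.
  rewrite -(sqnorm_shift x (-1)).
  apply: (@sqnormM (fun j => real_complex R (a (j - 1)))) => k.
  by rewrite /= expr0n addr0 sqrtr_sqr.
by rewrite !sqnorm_shift !leeD.
Qed.

Definition bounded_seq a := exists M : R, forall k, `|a k| <= M.

Lemma tridiag_square_summable a (ba : bounded_seq a) (x : ell2) :
  tridiag_fun a x \in square_summable.
Proof.
case: ba => M aM; apply/asboolP; apply: le_lt_trans (sqnorm_tridiag x aM) _.
have /asboolP xoo := ell2P x.
have Moo : ((M ^+ 2)%:E * sqnorm x < +oo)%E.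
  by rewrite lte_mul_pinfty ?lee_fin ?sqr_ge0.
by rewrite !lte_add_pinfty.
Qed.

Definition tridiag_op a (ba : bounded_seq a) (x : ell2) : ell2 :=
  Ell2 (tridiag_square_summable ba x).

Lemma tridiag_op_linear a (ba : bounded_seq a) : linear (tridiag_op ba).
Proof.
move=> z x y; apply/val_inj/funext => j /=.
rewrite tridiag_funE.
rewrite -[RHS]/(z * tridiag_fun a x j + tridiag_fun a y j) !tridiag_funE.
rewrite -[LHS]/(z * x (j + 1) + y (j + 1)
  + real_complex R (a (j - 1)) * (z * x (j - 1) + y (j - 1))).
by rewrite !mulrDr addrACA mulrCA.
Qed.

Lemma periodic_bounded a n :
  (forall k, a k = a (k + n.+1%:Z)) -> bounded_seq a.
Proof.
move=> ha.
have hz (q k : int) : a (k + q * n.+1%:Z) = a k.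
  have hn (p : nat) l : a (l + p%:Z * n.+1%:Z) = a l.
    elim: p => [|p IH]; first by rewrite mul0r addr0.
    by rewrite -[RHS]IH [RHS]ha -addrA; congr (a (_ + _)); lia.
  case: q => [p|p]; first exact: hn.
  rewrite -(hn p.+1 (k + _)); congr (a _).
  by rewrite NegzE mulNr subrK.
exists (\sum_(i < n.+1) `|a i%:Z|) => k.
rewrite (divz_eq k n.+1%:Z) addrC hz.
have r_ge0 : 0 <= (k %% n.+1%:Z)%Z by rewrite modz_ge0.
have r_lt : (absz (k %% n.+1%:Z)%Z < n.+1)%N.
  by rewrite -ltz_nat gez0_abs// ltz_pmod.
rewrite -[X in `|a X|]gez0_abs// (bigD1 (Ordinal r_lt))//= lerDl.
exact: sumr_ge0.
Qed.

Definition cV_ip m (u v : 'cV[R[i]]_m) : R[i] :=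
  \sum_i u i 0 * Num.conj (v i 0).

(* Rows and columns are numbered from 0 here, hence the shift of index; the
   entry in the bottom row, below the diagonal, is [a n.+1], which is [a 0] in
   the periodic case. *)
Definition corner_mx n a (s : R[i]) : 'M[R[i]]_n.+1 :=
  \matrix_(i, j)
    if i == j then if (i == ord0) || (i == ord_max) then s else 0
    else if (j == i.+1 :> nat) then 1
    else if (i == j.+1 :> nat) then real_complex R (a i.+1%:Z) else 0.

(* The word a_2 a_3 ... a_n a_0. *)
Definition period_word n a : seq R :=
  rcons [seq a k%:Z | k <- iota 2 n.-1] (a 0).

End SquareSummable.

(* Main.v *)
Require Import Defs.
From HB Require Import structures.
From mathcomp Require Import all_boot all_order all_algebra.
From mathcomp Require Import all_classical all_reals all_analysis.
From mathcomp Require Import complex.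
From mathcomp Require Import zify ring lra.

(* Cut Z into blocks of n + 1 sites at the couplings a_1 = 1. A coupling between
   the end p of a block and the start q of the next one contributes 2 Re(p q^* ),
   which lies between -(|p|^2 + |q|^2) and |p|^2 + |q|^2; summed over a finitely
   supported vector these contributions are s times the sum of all |p|^2 + |q|^2
   for some s in [-1, 1], and A^s is a convex combination of A^+ and A^-. This
   puts W(A_a) in the numerical range of the block diagonal matrix
   diag(A^+, A^-), which is conv(W(A^+) u W(A^-)) by Toeplitz-Hausdorff and is
   closed by compactness.
   Conversely, the palindrome condition says that the conjugate reversal of a
   block has the same form as the block. Choosing phases, a vector u can be
   continued to a chain of alternately reversed copies whose values on the two
   sides of every cut are equal (or all opposite), so that each block contributes
   exactly <A^+ u, u> (or <A^- u, u>). A long chain for u followed by an equally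
   long one for v approximates <A^+ u, u> + <A^- v, v>. *)

Set Implicit Arguments.
Unset Strict Implicit.
Unset Printing Implicit Defensive.

Import Order.TTheory GRing.Theory Num.Theory numFieldNormedType.Exports.
Import Normc.

Local Open Scope classical_set_scope.
Local Open Scope ring_scope.

(** * The standard inner product and the Toeplitz-Hausdorff theorem *)

Section InnerProduct.
Variables (R : realType) (m : nat).
Implicit Types (u v w x y z : 'cV[R[i]]_m) (c t : R[i]) (M : 'M[R[i]]_m).

Lemma cV_ipDl u v w : cV_ip (u + v) w = cV_ip u w + cV_ip v w.
Proof. by rewrite -big_split; apply: eq_bigr => i _; rewrite mxE mulrDl. Qed.

Lemma cV_ipDr u v w : cV_ip w (u + v) = cV_ip w u + cV_ip w v.
Proof.
by rewrite -big_split; apply: eq_bigr => i _; rewrite mxE rmorphD mulrDr.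
Qed.

Lemma cV_ipZl c u v : cV_ip (c *: u) v = c * cV_ip u v.
Proof. by rewrite mulr_sumr; apply: eq_bigr => i _; rewrite mxE mulrA. Qed.

Lemma cV_ipZr c u v : cV_ip u (c *: v) = Num.conj c * cV_ip u v.
Proof.
by rewrite mulr_sumr; apply: eq_bigr => i _; rewrite mxE rmorphM mulrCA.
Qed.

Lemma cV_ip_conj u v : Num.conj (cV_ip u v) = cV_ip v u.
Proof.
by rewrite rmorph_sum; apply: eq_bigr => i _; rewrite rmorphM/= conjCK mulrC.
Qed.

Lemma cV_ip_ge0 u : 0 <= cV_ip u u.
Proof. by apply: sumr_ge0 => i _; exact: mul_conjC_ge0. Qed.

Lemma cV_ip0l v : cV_ip 0 v = 0.
Proof. by rewrite -[0](scale0r 0) cV_ipZl mul0r. Qed.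

Lemma cV_ip_eq0 u : (cV_ip u u == 0) = (u == 0).
Proof.
apply/idP/eqP => [|->]; last by rewrite cV_ip0l.
rewrite psumr_eq0 => [/allP u0|i _]; last exact: mul_conjC_ge0.
apply/matrixP => i j; rewrite ord1 mxE.
by have := u0 i (mem_index_enum i); rewrite mul_conjC_eq0 => /eqP.
Qed.

Lemma numrangeP M (w : R[i]) :
  numrange (@cV_ip R m) (mulmx M) w <->
  exists z, cV_ip z z = 1 /\ cV_ip (M *m z) z = w.
Proof.
split=> [[z /= z1 <-]|[z [z1 <-]]]; exists z => //=; last by rewrite z1 sqrtC1.
by split=> //; rewrite -[LHS]sqrtCK z1 expr1n.
Qed.

(** Multiplying [z] by the square root of [t] scales both quadratic forms by [t]. This serves to
    normalise vectors and to distribute weights among them. *)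
Lemma quadratic_form_scale M z t : 0 <= t ->
  exists z', cV_ip z' z' = t * cV_ip z z /\
             cV_ip (M *m z') z' = t * cV_ip (M *m z) z.
Proof.
move=> t0; have s0 : Num.conj (sqrtC t) = sqrtC t.
  by apply/eqP; rewrite -CrealE ger0_real// sqrtC_ge0.
exists (sqrtC t *: z).
by rewrite -scalemxAr !cV_ipZl !cV_ipZr s0 !mulrA -expr2 sqrtCK.
Qed.

(** The leading coefficient is positive and the constant term is at most 0, so the discriminant [D]
    is nonnegative and the root with [+ sqrtC D] is real. *)
Lemma quadratic_form_root (t G : R[i]) : 0 <= t -> t < 1 -> G \is Num.real ->
  exists2 s, s \is Num.real & (1 - t) * s ^+ 2 + G * s - t = 0.
Proof.
move=> t0 t1 Gr; set D := G ^+ 2 + 4 * t * (1 - t).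
have t1' : 0 < 1 - t by rewrite subr_gt0.
have D0 : 0 <= D.
  by rewrite addr_ge0// ?real_exprn_even_ge0// !mulr_ge0// ltW.
set k := 1 - t in D D0 t1' *.
have k2 : 2 * k != 0 by rewrite mulf_neq0 ?pnatr_eq0// gt_eqF.
have sE : 2 * k * ((sqrtC D - G) / (2 * k)) + G = sqrtC D.
  by rewrite mulrC divfK// subrK.
exists ((sqrtC D - G) / (2 * k)).
  rewrite realM ?realV ?realB ?realM//; first by rewrite ger0_real// sqrtC_ge0.
  exact: gtr0_real.
move: sE; set s := _ / _ => sE.
apply: (mulfI (x := 4 * k)); first by rewrite mulf_neq0 ?pnatr_eq0// gt_eqF.
have := sqrtCK D; rewrite -sE => sqE.
transitivity ((2 * k * s + G) ^+ 2 - D); first by rewrite /D; ring.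
by rewrite sqE subrr mulr0.
Qed.

(** The expression has the same imaginary part as [c * (be - Num.conj al)], so [c] only has to
    rotate the number [be - Num.conj al] onto the real axis. *)
Lemma real_cross_phase (al be : R[i]) : exists c : R[i],
  c * Num.conj c = 1 /\ (Num.conj c * al + c * be \is Num.real).
Proof.
have [c [cc cd]] : exists c : R[i], c * Num.conj c = 1 /\
    c * (be - Num.conj al) \is Num.real.
  have [->|de0] := eqVneq (be - Num.conj al) 0.
    by exists 1; rewrite rmorph1 !mulr0 mulr1.
  set de := be - _ in de0 *; exists (Num.conj de / `|de|).
  have n0 : `|de| != 0 by rewrite normr_eq0.
  have nc : Num.conj `|de| = `|de| by apply/eqP; rewrite -CrealE normr_real.
  have dd : de * Num.conj de = `|de| ^+ 2 by rewrite normCK.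
  split.
    rewrite rmorphM/= conjCK fmorphV/= nc mulrACA [X in X * _]mulrC dd expr2.
    by rewrite -invfM divff// mulf_neq0.
  by rewrite mulrAC [X in X / _]mulrC dd expr2 mulfK// normr_real.
exists c; split=> //; rewrite CrealE; apply/eqP.
move: cd; rewrite CrealE => /eqP.
rewrite rmorphM rmorphB/= conjCK rmorphD !rmorphM/= conjCK => h.
have h' : Num.conj c * Num.conj be = c * (be - Num.conj al) + Num.conj c * al.
  by rewrite -h; ring.
by rewrite h'; ring.
Qed.

(* Toeplitz-Hausdorff: shift and rescale [M] so that the two values become 0
   and 1, and choose the phase [c] that makes the cross term of
   [x + s c y] real; the value [t] is then reached at a root of a quadratic
   equation in [s]. *)
Lemma numrange_segment M x y t : cV_ip x x = 1 -> cV_ip y y = 1 ->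
    0 <= t -> t < 1 ->
  exists z, cV_ip z z = 1 /\
    cV_ip (M *m z) z = (1 - t) * cV_ip (M *m x) x + t * cV_ip (M *m y) y.
Proof.
move=> x1 y1 t0 t1; set p := cV_ip (M *m x) x; set q := cV_ip (M *m y) y.
have [pq|pNq] := eqVneq p q; first by exists x; rewrite -/p -pq; split=> //; ring.
have d0 : q - p != 0 by rewrite subr_eq0 eq_sym.
(* [al] and [be] are the mixed values of the form of [(M - p) / (q - p)], whose values at [x] and
   [y] are 0 and 1. *)
set al := (cV_ip (M *m x) y - p * cV_ip x y) / (q - p).
set be := (cV_ip (M *m y) x - p * cV_ip y x) / (q - p).
have [c [cc creal]] := real_cross_phase al be.
set g := _ + _ in creal.
set h := Num.conj c * cV_ip x y + c * cV_ip y x.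
have hreal : h \is Num.real.
  rewrite CrealE /h rmorphD !rmorphM/= conjCK !cV_ip_conj addrC; exact: eqxx.
have Greal : g - t * h \is Num.real by rewrite realB ?realM// ger0_real.
(* Reaching the value [t] at [x + s c y] means [s^2 + s g = t (1 + s^2 + s h)], which is the
   quadratic equation with [G = g - t h]. *)
have [s sreal seq0] := quadratic_form_root t0 t1 Greal.
have sc : Num.conj s = s by apply/eqP; rewrite -CrealE.
set z := x + (s * c) *: y.
have cxy : Num.conj (s * c) = s * Num.conj c by rewrite rmorphM/= sc.
have zz : cV_ip z z = 1 + s ^+ 2 + s * h.
  rewrite /z cV_ipDl !cV_ipDr !cV_ipZl !cV_ipZr cxy x1 y1 /h.
  transitivity (1 + s * s * (c * Num.conj c) +
    s * (Num.conj c * cV_ip x y + c * cV_ip y x)); first by ring.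
  by rewrite cc; ring.
have Mzz : cV_ip (M *m z) z = p * cV_ip z z + (q - p) * (s ^+ 2 + s * g).
  have galE : (q - p) * g =
      Num.conj c * (cV_ip (M *m x) y - p * cV_ip x y) +
      c * (cV_ip (M *m y) x - p * cV_ip y x).
    have aE : (q - p) * al = cV_ip (M *m x) y - p * cV_ip x y.
      by rewrite mulrC divfK.
    have bE : (q - p) * be = cV_ip (M *m y) x - p * cV_ip y x.
      by rewrite mulrC divfK.
    by rewrite -aE -bE /g; ring.
  rewrite mulrDr [_ * (s * g)]mulrCA galE zz /h /z mulmxDr -scalemxAr.
  rewrite cV_ipDl !cV_ipDr !cV_ipZl !cV_ipZr cxy -/p -/q.
  transitivity (p + s * s * (c * Num.conj c) * q +
    s * (Num.conj c * cV_ip (M *m x) y + c * cV_ip (M *m y) x)); first by ring.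
  by rewrite cc; ring.
(* Otherwise [x] would be a multiple of [y] by a number of modulus 1, and [p] would equal [q]. *)
have z0 : cV_ip z z != 0.
  apply: contraNneq pNq => /eqP; rewrite cV_ip_eq0 => /eqP z0.
  have xE : x = - (s * c) *: y.
    by rewrite scaleNr; apply/eqP; rewrite -addr_eq0; apply/eqP.
  have ss : (- (s * c)) * Num.conj (- (s * c)) = 1.
    by move: x1; rewrite xE cV_ipZl cV_ipZr y1 mulr1.
  by rewrite /p xE -scalemxAr cV_ipZl cV_ipZr mulrA ss mul1r.
have zV0 : 0 <= (cV_ip z z)^-1 by rewrite invr_ge0 cV_ip_ge0.
have [z' [z'1 z'M]] := quadratic_form_scale M z zV0.
exists z'; rewrite z'1 z'M mulVf//; split=> //.
apply: (mulfI z0); rewrite mulVKf// Mzz.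
have -> : s ^+ 2 + s * g = t * cV_ip z z.
  by apply/eqP; rewrite -subr_eq0 -[X in _ == X]seq0 zz; apply/eqP; ring.
by ring.
Qed.

Lemma numrange_convex M : @convex_set R[i] R[i]^o (numrange (@cV_ip R m) (mulmx M)).
Proof.
apply/convex_setW => w1 w2 /set_mem/numrangeP[x [x1 xw]] /set_mem/numrangeP[y [y1 yw]].
move=> l l0 l1; apply/mem_set/numrangeP.
have [||z [z1 zw]] := @numrange_segment M x y (1 - l%:num) x1 y1.
- by rewrite subr_ge0 ltW.
- by rewrite ltrBlDr ltrDl.
by exists z; rewrite zw xw yw subKr.
Qed.

(** Homogeneous form of Toeplitz-Hausdorff: the pairs [(cV_ip z z, cV_ip (M *m z) z)] form a convex
    cone. Normalise both vectors, join them with weights proportional to their squared norms, and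
    scale back. *)
Lemma quadratic_form_add M x y : exists z,
  cV_ip z z = cV_ip x x + cV_ip y y /\
  cV_ip (M *m z) z = cV_ip (M *m x) x + cV_ip (M *m y) y.
Proof.
have [->|x0] := eqVneq x 0; first by exists y; rewrite mulmx0 !cV_ip0l !add0r.
have [->|y0] := eqVneq y 0; first by exists x; rewrite mulmx0 !cV_ip0l !addr0.
have pos u : u != 0 -> 0 < cV_ip u u.
  by move=> u0; rewrite lt_def cV_ip_ge0 cV_ip_eq0 u0.
have xp := pos x x0; have yp := pos y y0.
have sp : 0 < cV_ip x x + cV_ip y y by rewrite addr_gt0.
have inv u : 0 < cV_ip u u -> 0 <= (cV_ip u u)^-1 by rewrite invr_ge0; exact: ltW.
have [x' [x'1 x'M]] := quadratic_form_scale M x (inv _ xp).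
have [y' [y'1 y'M]] := quadratic_form_scale M y (inv _ yp).
rewrite mulVf ?gt_eqF// in x'1; rewrite mulVf ?gt_eqF// in y'1.
have [||z [z1 zM]] := @numrange_segment M x' y'
    (cV_ip y y / (cV_ip x x + cV_ip y y)) x'1 y'1.
- by rewrite divr_ge0 ?ltW.
- by rewrite ltr_pdivrMr// mul1r ltrDr.
have [w [w1 wM]] := quadratic_form_scale M z (ltW sp).
exists w; rewrite w1 wM z1 zM mulr1 x'M y'M; split=> //.
field; rewrite !gt_eqF//.
Qed.

End InnerProduct.

(** * Compactness of the numerical range of a matrix *)

Section ComplexLimits.
Variable R : realType.

Lemma normCE (z : R[i]) : `|z| = real_complex R (normc z).
Proof. by rewrite normc_def; case: z. Qed.

Lemma real_complex_continuous : continuous (real_complex R : R -> R[i]^o).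
Proof.
move=> x; apply/cvgrPdist_lt => e e0.
have er : e = real_complex R (complex.Re e).
  by rewrite RRe_real// gtr0_real.
have re0 : 0 < complex.Re e by rewrite -ltcR -er.
near=> y.
rewrite er -raddfB/= normCE ltcR /= expr0n addr0 sqrtr_sqr.
near: y; apply: (@cvgr_dist_lt _ R^o R (nbhs x)) => //; exact: cvg_id.
Unshelve. all: by end_near. Qed.

Lemma complexE_conj (a b : R) :
  Num.conj (a +i* b)%C = real_complex R a - 'i%C * real_complex R b.
Proof. by apply/eqP; rewrite eq_complex /=; simpc. Qed.

(** Identifies C^m with R^(2m), where the unit sphere is compact because it is bounded and
    closed. *)
Definition cV_of_rV m (x : 'rV[R]_(m + m)) : 'cV[R[i]]_m :=
  \col_i Complex (x 0 (lshift m i)) (x 0 (rshift m i)).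

Lemma cV_ip_of_rV m (x : 'rV[R]_(m + m)) :
  cV_ip (cV_of_rV x) (cV_of_rV x) = real_complex R (\sum_j x 0 j ^+ 2).
Proof.
rewrite big_split_ord /= raddfD /= !raddf_sum -big_split /=.
apply: eq_bigr => i _; rewrite mxE -normCK normCE -rmorphXn/= sqr_sqrtr.
  by rewrite raddfD.
by rewrite addr_ge0 ?sqr_ge0.
Qed.

Lemma quadratic_form_of_rV_continuous m (M : 'M[R[i]]_m) :
  continuous (fun x : 'rV[R]_(m + m) =>
    cV_ip (M *m cV_of_rV x) (cV_of_rV x) : R[i]^o).
Proof.
have cc j : continuous (fun x : 'rV[R]_(m + m) => real_complex R (x 0 j) : R[i]^o).
  move=> x; apply: (@continuous_comp _ _ _ (fun x : 'rV[R]_(m + m) => x 0 j)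
    (real_complex R : R -> R[i]^o)); first exact: coord_continuous.
  exact: real_complex_continuous.
have c1 j : continuous (fun x : 'rV[R]_(m + m) => cV_of_rV x j 0 : R[i]^o).
  rewrite (_ : (fun _ => _) = fun x : 'rV[R]_(m + m) =>
    real_complex R (x 0 (lshift m j)) + 'i%C * real_complex R (x 0 (rshift m j))).
    by move=> x; exact: cvgD (cc _ x) (cvgMl_tmp (cc _ x)).
  by apply/funext => x; rewrite mxE [LHS]complexE.
have c2 j : continuous (fun x : 'rV[R]_(m + m) => Num.conj (cV_of_rV x j 0) : R[i]^o).
  rewrite (_ : (fun _ => _) = fun x : 'rV[R]_(m + m) =>
    real_complex R (x 0 (lshift m j)) - 'i%C * real_complex R (x 0 (rshift m j))).
    by move=> x; exact: cvgB (cc _ x) (cvgMl_tmp (cc _ x)).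
  by apply/funext => x; rewrite mxE complexE_conj.
have csum (I : finType) (F : I -> 'rV[R]_(m + m) -> R[i]^o) :
    (forall i, continuous (F i)) -> continuous (fun x => \sum_i F i x).
  move=> cF x; apply: cvg_big => [||i _]; last exact: cF.
    exact: add_continuous.
  exact: nbhs_filter.
have c3 i : continuous (fun x : 'rV[R]_(m + m) => (M *m cV_of_rV x) i 0 : R[i]^o).
  rewrite (_ : (fun _ => _) = fun x : 'rV[R]_(m + m) => \sum_j M i j * cV_of_rV x j 0).
    by apply: csum => j x; exact: cvgMl_tmp (c1 _ _).
  by apply/funext => y; rewrite mxE.
by apply: csum => i x; exact: cvgM (c3 i x) (c2 i x).
Qed.

(** The numerical range is the image of the compact unit sphere [K] of R^(2m) under a continuous
    map. *)
Lemma numrange_closed m (M : 'M[R[i]]_m) :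
  closed (numrange (@cV_ip R m) (mulmx M) : set R[i]^o).
Proof.
pose K := [set x : 'rV[R]_(m + m) | \sum_j x 0 j ^+ 2 = 1].
rewrite (_ : numrange _ _ = (fun x : 'rV[R]_(m + m) =>
    cV_ip (M *m cV_of_rV x) (cV_of_rV x) : R[i]^o) @` K).
  apply: compact_closed; first exact: norm_hausdorff.
  apply: continuous_compact.
    by apply: continuous_subspaceT; exact: quadratic_form_of_rV_continuous.
  apply: bounded_closed_compact.
    exists 1; split=> // e e1 x Kx.
    rewrite /Num.norm/= mx_normrE; apply/bigmax_leP; split=> [|[i j] _ /=].
      by rewrite ltW// (lt_trans _ e1).
    rewrite ord1 (le_trans _ (ltW e1))// -(@ler_pXn2r _ 2)// ?nnegrE//.
    rewrite expr1n -Kx (bigD1 j)//= real_normK ?num_real// lerDl.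
    by apply: sumr_ge0 => k _; exact: sqr_ge0.
  have -> : K = (fun x : 'rV[R]_(m + m) => \sum_j x 0 j ^+ 2) @^-1` [set 1] by [].
  apply: preimage_closed; last exact: closed_eq.
  move=> x _; apply: cvg_big => [||i _]; first exact: add_continuous.
    exact: nbhs_filter.
  exact: cvgM (@coord_continuous _ _ _ _ i x) (@coord_continuous _ _ _ _ i x).
apply/seteqP; split=> w.
  move=> /numrangeP[z [z1 <-]].
  have zE : z = cV_of_rV (row_mx (\row_i complex.Re (z i 0)) (\row_i complex.Im (z i 0))).
    apply/matrixP => i j; rewrite ord1 [RHS]mxE.
    by rewrite row_mxEl row_mxEr !mxE; case: (z i 0).
  rewrite {}zE in z1 *; set x := row_mx _ _ in z1 *; exists x => //.
  by move: z1; rewrite cV_ip_of_rV => -[].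
move=> [x /= x1 <-]; apply/numrangeP; exists (cV_of_rV x).
by rewrite cV_ip_of_rV x1.
Qed.

End ComplexLimits.

(** * The convex hull of two numerical ranges as the numerical range of a direct sum *)

Section BlockDiagonal.
Variables (R : realType) (m1 m2 : nat).

Lemma cV_ip_col_mx (u u' : 'cV[R[i]]_m1) (v v' : 'cV[R[i]]_m2) :
  cV_ip (col_mx u v) (col_mx u' v') = cV_ip u u' + cV_ip v v'.
Proof.
rewrite /cV_ip big_split_ord /=; congr (_ + _).
  by apply: eq_bigr => i _; rewrite !col_mxEu.
by apply: eq_bigr => i _; rewrite !col_mxEd.
Qed.

Lemma mul_block_diag_col (A : 'M[R[i]]_m1) (B : 'M[R[i]]_m2) u v :
  block_mx A 0 0 B *m col_mx u v = col_mx (A *m u) (B *m v) :> 'cV_(m1 + m2).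
Proof. by rewrite mul_block_col !mul0mx addr0 add0r. Qed.

(** The right side is convex and contains both ranges, by padding with zeros. Conversely, the form
    at a unit vector [(u, v)] is the convex combination, with weights [|u|^2] and [|v|^2], of the
    values at the normalised parts. *)
Lemma conv_hull_numrangeU (A : 'M[R[i]]_m1) (B : 'M[R[i]]_m2) :
  conv_hull (numrange (@cV_ip R m1) (mulmx A) `|` numrange (@cV_ip R m2) (mulmx B)) =
  numrange (@cV_ip R (m1 + m2)) (mulmx (block_mx A 0 0 B)).
Proof.
apply/seteqP; split.
  apply: smallest_sub; first exact: numrange_convex.
  move=> w [] /numrangeP[z [z1 zw]]; apply/numrangeP.
    exists (col_mx z 0); rewrite mul_block_diag_col !cV_ip_col_mx.
    by rewrite mulmx0 !cV_ip0l !addr0.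
  exists (col_mx 0 z); rewrite mul_block_diag_col !cV_ip_col_mx.
  by rewrite mulmx0 !cV_ip0l !add0r.
move=> w /numrangeP[z]; rewrite -(vsubmxK z).
set u := usubmx z; set v := dsubmx z.
rewrite mul_block_diag_col !cV_ip_col_mx => -[n1 <-] K [Kconv Ksub].
(* A zero part cannot be normalised; the value then lies in one of the two ranges. *)
have [u0|u0] := eqVneq u 0.
  rewrite u0 mulmx0 !cV_ip0l !add0r in n1 *.
  by apply: Ksub; right; apply/numrangeP; exists v.
have [v0|v0] := eqVneq v 0.
  rewrite v0 mulmx0 !cV_ip0l !addr0 in n1 *.
  by apply: Ksub; left; apply/numrangeP; exists u.
have un0 : cV_ip u u != 0 by rewrite cV_ip_eq0.
have vn0 : cV_ip v v != 0 by rewrite cV_ip_eq0.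
have inv m (x : 'cV[R[i]]_m) : 0 <= (cV_ip x x)^-1 by rewrite invr_ge0 cV_ip_ge0.
have [u' [u'1 u'A]] := quadratic_form_scale A u (inv _ u).
have [v' [v'1 v'B]] := quadratic_form_scale B v (inv _ v).
rewrite mulVf// in u'1; rewrite mulVf// in v'1.
have a1 : cV_ip u u <= 1 by rewrite -n1 lerDl cV_ip_ge0.
have := Kconv _ _ (Itv01 (cV_ip_ge0 u) a1)
  (mem_set (Ksub _ (or_introl (proj2 (numrangeP _ _) (ex_intro _ u' (conj u'1 u'A))))))
  (mem_set (Ksub _ (or_intror (proj2 (numrangeP _ _) (ex_intro _ v' (conj v'1 v'B)))))).
move=> /set_mem; congr (K _).
transitivity (cV_ip u u * ((cV_ip u u)^-1 * cV_ip (A *m u) u) +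
    (1 - cV_ip u u) * ((cV_ip v v)^-1 * cV_ip (B *m v) v)); first by [].
have -> : 1 - cV_ip u u = cV_ip v v by rewrite -n1 addrC addKr.
by rewrite !mulVKf.
Qed.

End BlockDiagonal.

(** * Symmetric partial sums of two-sided series *)

Section SymmetricSums.
Variable R : realType.

Definition symsum (V : zmodType) (f : int -> V) (L : nat) : V :=
  \sum_(i < L.*2.+1) f (i%:Z - L%:Z).

Lemma symsumS (V : zmodType) (f : int -> V) L :
  symsum f L.+1 = symsum f L + (f L.+1%:Z + f (- L.+1%:Z)).
Proof.
rewrite /symsum doubleS big_ord_recl big_ord_recr /= addrCA.
rewrite [f _ + f _ in LHS]addrC; congr (_ + (_ + _)).
- by apply: eq_bigr => i _; congr f; rewrite /bump /=; lia.
- by congr f; rewrite /bump /=; lia.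
- by congr f; lia.
Qed.

(** Pairing [k] with [-k] gives a one-sided series, to which the usual convergence criteria
    apply. *)
Lemma symsumE (V : zmodType) (f : int -> V) L :
  symsum f L = f 0 + \sum_(0 <= l < L) (f l.+1%:Z + f (- l.+1%:Z)).
Proof.
elim: L => [|L IH]; first by rewrite /symsum big_ord1 big_geq// subr0 addr0.
by rewrite symsumS IH big_nat_recr//= -addrA.
Qed.

Lemma symsum_is_cvg (g h : int -> R) (B : R) :
  (forall k, `|g k| <= h k) -> (forall L, symsum h L <= B) ->
  cvgn (symsum g).
Proof.
move=> gh hB.
have h0 k : 0 <= h k := le_trans (normr_ge0 _) (gh k).
pose u (f : int -> R) := (fun l : nat => f l.+1%:Z + f (- l.+1%:Z)) : R^nat.
have cv : cvgn (series (u h)).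
  apply: nondecreasing_is_cvgn.
    by apply: nondecreasing_series => l _ _; rewrite addr_ge0.
  exists B => _ [L _ <-]; apply: le_trans (hB L).
  by rewrite symsumE /series/= lerDr.
have cu : cvgn (series (u g)).
  apply: normed_cvg; apply: series_le_cvg cv => l; first exact: normr_ge0.
    exact: addr_ge0.
  by apply: le_trans (ler_normD _ _) _; exact: lerD.
rewrite (_ : symsum g = fun L => g 0 + series (u g) L); last first.
  by apply/funext => L; rewrite symsumE.
by apply: is_cvgD => //; exact: is_cvg_cst.
Qed.

Lemma symsum_tail (h : int -> R) (B : R) :
  (forall k, 0 <= h k) -> (forall L, symsum h L <= B) ->
  (fun l : nat => h l.+1%:Z + h (- l.+1%:Z)) @ \oo --> 0.
Proof.
move=> h0 hB; apply: cvg_series_cvg_0; apply: nondecreasing_is_cvgn.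
  by apply: nondecreasing_series => l _ _; rewrite addr_ge0.
exists B => _ [L _ <-]; apply: le_trans (hB L).
by rewrite symsumE /series/= lerDr.
Qed.

Lemma normr_Re_le (z : R[i]) : `|complex.Re z| <= normc z.
Proof. by case: z => u v /=; rewrite -sqrtr_sqr ler_wsqrtr// lerDl sqr_ge0. Qed.

Lemma normr_Im_le (z : R[i]) : `|complex.Im z| <= normc z.
Proof. by case: z => u v /=; rewrite -sqrtr_sqr ler_wsqrtr// lerDr sqr_ge0. Qed.

Lemma symsum_complex_is_cvg (f : int -> R[i]) (h : int -> R) (B : R) :
  (forall k, normc (f k) <= h k) -> (forall L, symsum h L <= B) ->
  cvgn (symsum f : nat -> R[i]^o).
Proof.
move=> fh hB.
have c1 : cvgn (symsum (fun k => complex.Re (f k))).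
  by apply: symsum_is_cvg hB => k; exact: le_trans (normr_Re_le _) (fh k).
have c2 : cvgn (symsum (fun k => complex.Im (f k))).
  by apply: symsum_is_cvg hB => k; exact: le_trans (normr_Im_le _) (fh k).
rewrite (_ : symsum f = fun L => real_complex R (symsum (fun k => complex.Re (f k)) L)
    + 'i%C * real_complex R (symsum (fun k => complex.Im (f k)) L)); last first.
  apply/funext => L; rewrite /symsum !raddf_sum mulr_sumr -big_split /=.
  by apply: eq_bigr => i _; rewrite [LHS]complexE.
have rc u : cvgn u -> (fun L : nat => real_complex R (u L) : R[i]^o) @ \oo -->
    (real_complex R (limn u) : R[i]^o).
  move=> cu; apply: (@cvg_comp _ _ _ u (real_complex R : R -> R[i]^o) _ (nbhs (limn u))).
    exact: cu.
  exact: real_complex_continuous.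
by apply: cvgP; exact: cvgD (rc _ c1) (cvgMl_tmp (rc _ c2)).
Qed.

(** Compares sums over two windows that both contain the support, through the sum over all of Z. *)
Lemma window_sum (V : zmodType) (f : int -> V) (c : int) (m : nat) :
  (forall k, f k != 0 -> c <= k < c + m%:Z) ->
  \sum_(i < m) f (c + i%:Z) = \sum_(k \in [set: int]) f k.
Proof.
move=> fs; rewrite (fsbigE [seq c + i%:Z | i <- iota 0 m]).
- rewrite big_map -(big_mkord xpredT (fun i => f (c + i%:Z))).
  by rewrite /index_iota subn0; apply: eq_big => // i; rewrite in_setT.
- by rewrite map_inj_uniq ?iota_uniq// => i j /addrI [].
- by [].
- move=> k _ kNm; apply/eqP; apply: contraNT kNm => /fs/andP[ck kc].
  by apply/mapP; exists `|k - c|%N; rewrite ?mem_iota; lia.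
Qed.

End SymmetricSums.

(** * The quadratic form of the operator as a limit of sums over couplings *)

Section Ell2.
Variable R : realType.
Implicit Types (x y : ell2 R) (a : int -> R).

Lemma symsum_sqnorm_le x L :
  symsum (fun k => normc (x k) ^+ 2) L <= fine (sqnorm x).
Proof.
have /asboolP xoo := ell2P x.
have p0 k : [set: int] k -> (0 <= (normc (x k) ^+ 2)%:E)%E.
  by move=> _; rewrite lee_fin sqr_ge0.
rewrite -lee_fin fineK; last by rewrite ge0_fin_numE ?xoo ?esum_ge0.
pose r := [seq i%:Z - L%:Z | i <- iota 0 L.*2.+1].
apply: ereal_sup_ubound; exists [set` r] => //; first by split; [exact: finite_seq|].
rewrite -fsbig_seq; last by rewrite map_inj_uniq ?iota_uniq// => i j /addIr [].
rewrite big_map sumEFin /symsum.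
rewrite -(big_mkord xpredT (fun i => normc (x (i%:Z - L%:Z)) ^+ 2)).
by rewrite /index_iota subn0.
Qed.

Lemma normc_mul_conj_le (u v : R[i]) :
  normc (u * Num.conj v) <= normc u ^+ 2 + normc v ^+ 2.
Proof.
rewrite normcM.
have -> : normc (Num.conj v) = normc v by apply: complexI; rewrite -!normCE norm_conjC.
have := sqr_ge0 (normc u - normc v); rewrite sqrrB.
by have := sqr_ge0 (normc u); have := sqr_ge0 (normc v); lra.
Qed.

Lemma ell2_ip_cvg x y :
  (symsum (fun k => x k * Num.conj (y k)) : nat -> R[i]^o) @ \oo -->
  (ell2_ip x y : R[i]^o).
Proof.
apply: (@symsum_complex_is_cvg _ _ (fun k => normc (x k) ^+ 2 + normc (y k) ^+ 2)
    (fine (sqnorm x) + fine (sqnorm y))) => [k|L].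
  exact: normc_mul_conj_le.
by rewrite /symsum big_split /= lerD ?symsum_sqnorm_le.
Qed.

(** The contribution of the matrix entries [(k, k+1)] and [(k+1, k)] to the quadratic form, that is,
    of the coupling between the sites [k] and [k + 1]. *)
Definition edge_form a (x : int -> R[i]) (k : int) : R[i] :=
  x (k + 1) * Num.conj (x k) + real_complex R (a k) * (x k * Num.conj (x (k + 1))).

(** Regrouping rows by couplings: the [2L] couplings inside the window are complete, and of each of
    the two that leave it one half remains. *)
Lemma symsum_tridiag a (x : int -> R[i]) L :
  symsum (fun k => tridiag_fun a x k * Num.conj (x k)) L =
  \sum_(i < L.*2) edge_form a x (i%:Z - L%:Z) +
  (x (L.+1%:Z) * Num.conj (x L%:Z) +
   real_complex R (a (- L.+1%:Z)) * (x (- L.+1%:Z) * Num.conj (x (- L%:Z)))).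
Proof.
rewrite /symsum; under eq_bigr do rewrite tridiag_funE mulrDl.
rewrite big_split big_ord_recr/= [X in _ + X = _]big_ord_recl/=.
rewrite [X in _ + X = _]addrC addrACA /edge_form big_split /=; congr (_ + _ + (_ + _)).
- apply: eq_bigr => i _; rewrite -mulrA.
  have -> : (bump 0 i)%:Z - L%:Z = i%:Z - L%:Z + 1 by rewrite /bump /=; lia.
  by rewrite addrK.
- by congr (x _ * Num.conj (x _)); lia.
- rewrite -mulrA; congr (real_complex R (a _) * (x _ * Num.conj (x _))); lia.
Qed.

Lemma squeeze_cvgC0 (u : nat -> R[i]) (e : nat -> R) :
  (forall l, normc (u l) <= e l) -> e @ \oo --> 0 ->
  (u : nat -> R[i]^o) @ \oo --> (0 : R[i]^o).
Proof.
move=> ue /cvgrPdist_lt e0; apply/cvgrPdist_lt => d d0.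
have dr : d = real_complex R (complex.Re d) by rewrite RRe_real// gtr0_real.
have rd0 : 0 < complex.Re d by rewrite -ltcR -dr.
near=> l.
rewrite dr sub0r normrN normCE ltcR (le_lt_trans (ue l))//.
rewrite (le_lt_trans (ler_norm _))//.
have : `|0 - e l| < complex.Re d by near: l; exact: e0.
by rewrite sub0r normrN.
Unshelve. all: by end_near. Qed.

(** Square summability makes the entries at the ends of the window tend to 0, and the weights are
    bounded. *)
Lemma ell2_boundary_cvg0 x a M : (forall k, `|a k| <= M) ->
  (fun L : nat => x (L.+1%:Z) * Num.conj (x L%:Z) +
   real_complex R (a (- L.+1%:Z)) * (x (- L.+1%:Z) * Num.conj (x (- L%:Z))) : R[i]^o)
   @ \oo --> (0 : R[i]^o).
Proof.
move=> aM; set u := (fun L : nat => _ : R[i]^o).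
pose h k := normc (x k) ^+ 2.
have h0 k : 0 <= h k by exact: sqr_ge0.
have v0 := symsum_tail h0 (symsum_sqnorm_le x).
set v := (fun l : nat => _) in v0.
(* [v l] holds the sites [l + 1] and [-(l + 1)], so after a shift by one the boundary term is
   controlled by [v l.+1] and [v l]. *)
suff : (fun l => u l.+1) @ \oo --> (0 : R[i]^o) by rewrite cvg_shiftS.
have v1 : (fun l => v l.+1) @ \oo --> (0 : R) by rewrite cvg_shiftS.
apply: (@squeeze_cvgC0 _ (fun l => (1 + M) * (v l.+1 + v l))) => [l|]; last first.
  by rewrite -(mulr0 (1 + M)) -[X in _ * X](addr0 0); exact: cvgMl_tmp (cvgD v1 v0).
have M0 : 0 <= M := le_trans (normr_ge0 _) (aM 0).
apply: le_trans (le_normcD _ _) _.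
have t1 := normc_mul_conj_le (x l.+2) (x l.+1).
have t2 := normc_mul_conj_le (x (- l.+2%:Z)) (x (- l.+1%:Z)).
have ra : normc (real_complex R (a (- l.+2%:Z))) <= M.
  by rewrite /= expr0n addr0 sqrtr_sqr.
have t3 := ler_pM (normc_ge0 _) (normc_ge0 _) ra t2.
rewrite -normcM in t3.
apply: le_trans (lerD t1 t3) _.
have := mulr_ge0 M0 (h0 l.+2); have := mulr_ge0 M0 (h0 l.+1).
have := h0 l.+1; have := h0 l.+2; have := h0 (- l.+1%:Z); have := h0 (- l.+2%:Z).
by rewrite /v /h !mulrDl !mulrDr !mul1r; lra.
Qed.

Lemma ell2_ip_tridiag_cvg a (ba : bounded_seq a) x :
  (fun L : nat => \sum_(i < L.*2) edge_form a x (i%:Z - L%:Z) : R[i]^o) @ \oo -->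
  (ell2_ip (tridiag_op ba x) x : R[i]^o).
Proof.
have [M aM] := ba.
rewrite -[ell2_ip _ _]subr0 (_ : (fun L => _) = (fun L : nat =>
    symsum (fun k => tridiag_fun a x k * Num.conj (x k)) L -
    (x (L.+1%:Z) * Num.conj (x L%:Z) + real_complex R (a (- L.+1%:Z)) *
      (x (- L.+1%:Z) * Num.conj (x (- L%:Z)))) : R[i]^o)).
  have h1 : (symsum (fun k => tridiag_fun a x k * Num.conj (x k)) : nat -> R[i]^o)
      @ \oo --> (ell2_ip (tridiag_op ba x) x : R[i]^o).
    exact: (@ell2_ip_cvg (tridiag_op ba x) x).
  have h := cvgB h1 (ell2_boundary_cvg0 x aM).
  exact: h.
by apply/funext => L; rewrite symsum_tridiag addrK.
Qed.

End Ell2.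

(** * Quadratic forms of the corner matrices and of chains of blocks *)

Section CornerForm.
Variables (R : realType) (n : nat) (a : int -> R).
Hypothesis n_gt0 : (0 < n)%N.
Implicit Types (f : nat -> R[i]) (s : R[i]).

(** Entries come from a function on [nat], so that neighbouring indices need no ordinal casts. *)
Definition colf f : 'cV[R[i]]_n.+1 := \col_(i < n.+1) f i.

Lemma colfK (w : 'cV[R[i]]_n.+1) : w = colf (fun k => w (inord k) 0).
Proof. by apply/matrixP => i j; rewrite ord1 mxE inord_val. Qed.

Lemma cV_ip_colf f : cV_ip (colf f) (colf f) = \sum_(i < n.+1) f i * Num.conj (f i).
Proof. by apply: eq_bigr => i _; rewrite mxE. Qed.

Lemma corner_mul_colf f s (i : 'I_n.+1) :
  (corner_mx n a s *m colf f) i 0 =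
  (if (i == 0 :> nat) || (i == n :> nat) then s * f i else 0) +
  (if (i < n)%N then f i.+1 else 0) +
  (if (0 < i)%N then real_complex R (a i.+1%:Z) * f i.-1 else 0).
Proof.
rewrite mxE.
pose F1 (j : nat) := if j == i then
  if (i == 0 :> nat) || (i == n :> nat) then s * f i else 0 else 0.
pose F2 (j : nat) := if j == i.+1 then f j else 0.
pose F3 (j : nat) := if (0 < i)%N && (j == i.-1) then
   real_complex R (a i.+1%:Z) * f j else 0.
transitivity (\sum_(j < n.+1) (F1 j + F2 j + F3 j)).
  apply: eq_bigr => j _; rewrite !mxE /F1 /F2 /F3.
  rewrite -!val_eqE /= [(i == j :> nat)]eq_sym.
  have [ij|ij] := eqVneq (j : nat) (i : nat).
    have -> : (j == i.+1 :> nat) = false by lia.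
    have -> : (0 < i)%N && (j == i.-1 :> nat) = false by lia.
    by rewrite ij !addr0; case: ifP => // _; rewrite mul0r.
  have [ij2|ij2] := eqVneq (j : nat) i.+1.
    have -> : (0 < i)%N && (j == i.-1 :> nat) = false by lia.
    by rewrite mul1r add0r addr0 ij2.
  have -> : (0 < i)%N && (j == i.-1 :> nat) = (i == j.+1 :> nat) by lia.
  by rewrite !add0r; case: ifP => // _; rewrite mul0r.
have pick (F : nat -> R[i]) (k : nat) :
    \sum_(j < n.+1) (if j == k :> nat then F j else 0) =
    if (k < n.+1)%N then F k else 0.
  rewrite -(big_mkord xpredT (fun j => if j == k then F j else 0)) -big_mkcond.
  by rewrite big_nat1_eq.
rewrite !big_split /= (pick (fun _ => _)) (pick f) ltn_ord ltnS; congr (_ + _ + _).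
rewrite /F3; case: ltnP => [i0|_] /=; last by rewrite big1.
rewrite (pick (fun j => real_complex R (a i.+1%:Z) * f j)).
by rewrite ifT//; have := ltn_ord i; lia.
Qed.

(** This is [2 Re (p conj q)], the form of a coupling of weight 1. *)
Definition boundary_form (p q : R[i]) := p * Num.conj q + q * Num.conj p.

(** The share of one block in a chain: its inner couplings, and the coupling of its last site to the
    first site of the next block. *)
Definition chain_term (w w' : 'cV[R[i]]_n.+1) : R[i] :=
  cV_ip (corner_mx n a 0 *m w) w + boundary_form (w ord_max 0) (w' ord0 0).

(** As [n] is positive, the two corners are different entries and each end of the block gets its own
    square. *)
Lemma corner_formE f s :
  cV_ip (corner_mx n a s *m colf f) (colf f) =
  s * (f 0 * Num.conj (f 0) + f n * Num.conj (f n)) +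
  \sum_(i < n) (f i.+1 * Num.conj (f i) +
    real_complex R (a i.+2%:Z) * (f i * Num.conj (f i.+1))).
Proof.
rewrite /cV_ip; under eq_bigr => i _ do rewrite corner_mul_colf mxE !mulrDl.
rewrite !big_split /= mulrDr -addrA; congr (_ + _); last congr (_ + _).
- case: n n_gt0 => // m _.
  rewrite big_ord_recl big_ord_recr /= big1 => [|i _]; last first.
    by rewrite /bump /= ifF ?mul0r//; have := ltn_ord i; lia.
  by rewrite add0r /bump /= ?eqxx ?orbT ?add1n ?eqxx ?orbT !mulrA.
- rewrite big_ord_recr /= ltnn mul0r addr0.
  by apply: eq_bigr => i _; rewrite ltn_ord.
- rewrite big_ord_recl /= mul0r add0r.
  by apply: eq_bigr => i _; rewrite mulrA.
Qed.

Lemma corner_form_shift s (w : 'cV[R[i]]_n.+1) :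
  cV_ip (corner_mx n a s *m w) w = cV_ip (corner_mx n a 0 *m w) w +
  s * (w ord0 0 * Num.conj (w ord0 0) + w ord_max 0 * Num.conj (w ord_max 0)).
Proof.
rewrite (colfK w) !corner_formE mul0r add0r addrC !mxE.
by congr (_ + s * _).
Qed.

Lemma boundary_form_le p q :
  boundary_form p q <= p * Num.conj p + q * Num.conj q /\
  - (p * Num.conj p + q * Num.conj q) <= boundary_form p q.
Proof.
have h1 := mul_conjC_ge0 (p - q); have h2 := mul_conjC_ge0 (p + q).
split; rewrite -subr_ge0.
  apply: le_trans h1 _; rewrite rmorphB /= /boundary_form.
  by rewrite le_eqVlt; apply/orP; left; apply/eqP; ring.
apply: le_trans h2 _; rewrite rmorphD /= /boundary_form.
by rewrite le_eqVlt; apply/orP; left; apply/eqP; ring.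
Qed.

Lemma quadratic_form_sum m (M : 'M[R[i]]_m) K (p r : nat -> R[i]) :
  (forall b, exists z, cV_ip z z = p b /\ cV_ip (M *m z) z = r b) ->
  exists z, cV_ip z z = \sum_(b < K) p b /\ cV_ip (M *m z) z = \sum_(b < K) r b.
Proof.
move=> h; elim: K => [|K [z [z1 zM]]].
  by exists 0; rewrite mulmx0 !cV_ip0l !big_ord0.
have [y [y1 yM]] := h K.
have [x [x1 xM]] := quadratic_form_add M z y.
by exists x; rewrite !big_ord_recr /= x1 xM z1 zM y1 yM.
Qed.

(* The total boundary contribution is [s] times its largest possible value for
   a single [s] in [-1, 1], and [corner_mx n a s] is a convex combination of
   the two corner matrices. *)
Lemma block_chain_form (w : nat -> 'cV[R[i]]_n.+1) K : w K = 0 ->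
  exists z : 'cV[R[i]]_(n.+1 + n.+1),
    cV_ip z z = \sum_(b < K) cV_ip (w b) (w b) /\
    cV_ip (block_mx (corner_mx n a 1) 0 0 (corner_mx n a (-1)) *m z) z =
    \sum_(b < K) chain_term (w b) (w b.+1).
Proof.
move=> wK.
pose F b := w b ord0 0 * Num.conj (w b ord0 0).
pose L b := w b ord_max 0 * Num.conj (w b ord_max 0).
pose B := \sum_(b < K) boundary_form (w b ord_max 0) (w b.+1 ord0 0).
pose S := \sum_(b < K) (F b + L b).
have F0 b : 0 <= F b by exact: mul_conjC_ge0.
have L0 b : 0 <= L b by exact: mul_conjC_ge0.
(* The shift from [F b] to [F b.+1] drops [F 0], which is nonnegative, and adds [F K], which is 0
   because [w K = 0]. *)
have SE : \sum_(b < K) (L b + F b.+1) <= S.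
  rewrite /S !big_split /= addrC lerD2r.
  have : \sum_(b < K.+1) F b = \sum_(b < K) F b.
    by rewrite big_ord_recr /= /F wK mxE mul0r addr0.
  by rewrite big_ord_recl /= => <-; rewrite lerDr.
have BS : B <= S.
  apply: le_trans SE; apply: ler_sum => b _.
  by have [] := boundary_form_le (w b ord_max 0) (w b.+1 ord0 0).
have BS' : - S <= B.
  apply: (@le_trans _ _ (- \sum_(b < K) (L b + F b.+1))); first by rewrite lerN2.
  rewrite -sumrN; apply: ler_sum => b _.
  by have [] := boundary_form_le (w b ord_max 0) (w b.+1 ord0 0).
have S0 : 0 <= S by apply: sumr_ge0 => b _; rewrite addr_ge0.
have [s [s1 s2 sS]] : exists s : R[i], [/\ -1 <= s, s <= 1 & B = s * S].
  have [SZ|SN] := eqVneq S 0.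
    exists 0; split; rewrite ?lerN10 ?ler01// mul0r; apply/eqP.
    by rewrite eq_le; rewrite SZ ?oppr0 in BS BS' *; rewrite BS BS'.
  have Sp : 0 < S by rewrite lt_def SN.
  exists (B / S); split; last by rewrite divfK.
    by rewrite ler_pdivlMr// mulN1r.
  by rewrite ler_pdivrMr// mul1r.
(* [(1 + s) / 2] and [(1 - s) / 2] are the weights of [A^+] and [A^-] in [A^s]. *)
have sp : 0 <= (1 + s) / 2 by rewrite divr_ge0// -lerBlDl sub0r.
have sm : 0 <= (1 - s) / 2 by rewrite divr_ge0// subr_ge0.
have split_corner b : exists z, cV_ip z z = cV_ip (w b) (w b) /\
    cV_ip (block_mx (corner_mx n a 1) 0 0 (corner_mx n a (-1)) *m z) z =
    cV_ip (corner_mx n a 0 *m w b) (w b) + s * (F b + L b).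
  have [u [u1 uM]] := quadratic_form_scale (corner_mx n a 1) (w b) sp.
  have [v [v1 vM]] := quadratic_form_scale (corner_mx n a (-1)) (w b) sm.
  exists (col_mx u v); rewrite mul_block_diag_col !cV_ip_col_mx u1 v1 uM vM.
  rewrite (corner_form_shift 1) (corner_form_shift (-1)) -/(F b) -/(L b).
  by split; field.
have [z [z1 zM]] := quadratic_form_sum K split_corner.
exists z; split=> //.
rewrite zM /chain_term [LHS]big_split [RHS]big_split /= -/B sS; congr (_ + _).
by rewrite -mulr_sumr.
Qed.

End CornerForm.

(** * The numerical range of the operator lies in that of the block diagonal matrix *)

Lemma cvgC_div (R : realType) (f g : nat -> R[i]^o) (u v : R[i]^o) : v != 0 ->
  f @ \oo --> u -> g @ \oo --> v ->
  (fun l => f l / g l : R[i]^o) @ \oo --> (u / v : R[i]^o).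
Proof.
move=> v0 fu gv; have gv' := cvgV v0 gv.
apply: (cvgM fu); exact: gv'.
Qed.

Section Blocks.
Variables (R : realType) (n : nat) (a : int -> R).
Hypothesis n_gt0 : (0 < n)%N.
Hypothesis a_periodic : forall k : int, a k = a (k + n.+1%:Z).
Hypothesis a1 : a 1 = 1.
Implicit Types (y : int -> R[i]).

Lemma periodic_shift (q k : int) : a (k + q * n.+1%:Z) = a k.
Proof.
have hn (p : nat) l : a (l + p%:Z * n.+1%:Z) = a l.
  elim: p => [|p IH]; first by rewrite mul0r addr0.
  by rewrite -[RHS]IH [RHS]a_periodic -addrA; congr (a (_ + _)); lia.
case: q => [p|p]; first exact: hn.
by rewrite -(hn p.+1 (k + _)); congr (a _); rewrite NegzE mulNr subrK.
Qed.

Lemma sum_blocks (V : zmodType) (g : nat -> V) K N :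
  \sum_(i < K * N) g i = \sum_(b < K) \sum_(i < N) g (b * N + i)%N.
Proof.
elim: K => [|K IH]; first by rewrite mul0n !big_ord0.
by rewrite mulSnr big_split_ord big_ord_recr /= IH.
Qed.

Definition block y (c : int) (b : nat) : 'cV[R[i]]_n.+1 :=
  colf n (fun i => y (c + (b * n.+1 + i)%N%:Z)).

Lemma sqnorm_sum_blocks y (c : int) K :
  \sum_(i < K * n.+1) y (c + i%:Z) * Num.conj (y (c + i%:Z)) =
  \sum_(b < K) cV_ip (block y c b) (block y c b).
Proof.
rewrite (sum_blocks (fun i => y (c + i%:Z) * Num.conj (y (c + i%:Z)))).
by apply: eq_bigr => b _; rewrite cV_ip_colf.
Qed.

(** Every block starts at a site congruent to 2 modulo [n + 1], so its inner couplings carry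
    [a_2, ..., a_n, a_0] and the one that leaves it carries [a_1 = 1]. *)
Lemma edge_sum_blocks y (p : int) K : let c := 2 + p * n.+1%:Z in
  \sum_(i < K * n.+1) edge_form a y (c + i%:Z) =
  \sum_(b < K) chain_term a (block y c b) (block y c b.+1).
Proof.
move=> c; rewrite (sum_blocks (fun i => edge_form a y (c + i%:Z))).
apply: eq_bigr => b _; rewrite /chain_term corner_formE// mul0r add0r big_ord_recr /=.
congr (_ + _).
  apply: eq_bigr => i _; rewrite /edge_form.
  have -> : c + (b * n.+1 + i)%N%:Z + 1 = c + (b * n.+1 + i.+1)%N%:Z by lia.
  congr (_ + real_complex R _ * _).
  rewrite -(periodic_shift (p + b%:Z) (i.+2)%:Z) /c; congr (a _).
  by rewrite mulrDl; lia.
rewrite /edge_form /boundary_form !mxE /=.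
have -> : c + (b * n.+1 + n)%N%:Z + 1 = c + (b.+1 * n.+1 + 0)%N%:Z by lia.
have -> : a (c + (b * n.+1 + n)%N%:Z) = 1.
  rewrite -a1 -(periodic_shift (p + b%:Z + 1) 1) /c; congr (a _).
  by rewrite !mulrDl; lia.
by rewrite mul1r addrC.
Qed.

(** Cutting [x] off outside [[-L, L]] leaves a finite chain of blocks, to which [block_chain_form]
    applies. *)
Lemma truncated_form (x : int -> R[i]) L :
  exists z : 'cV[R[i]]_(n.+1 + n.+1),
    cV_ip z z = symsum (fun k => x k * Num.conj (x k)) L /\
    cV_ip (block_mx (corner_mx n a 1) 0 0 (corner_mx n a (-1)) *m z) z =
    \sum_(i < L.*2) edge_form a x (i%:Z - L%:Z).
Proof.
pose y k := if (- L%:Z <= k) && (k <= L%:Z) then x k else 0.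
have y0 k : ~~ ((- L%:Z <= k) && (k <= L%:Z)) -> y k = 0 by rewrite /y => /negbTE ->.
(* The blocks fill the sites from [2 - (L+2)(n+1)] up to but excluding [2 + (L+2)(n+1)], which
   covers [[-L, L]]. *)
pose p : int := - (L.+2)%:Z; pose c : int := 2 + p * n.+1%:Z.
pose K := (L.+2 * 2)%N.
have cL : c <= - L%:Z - 1.
  by rewrite /c /p; case: n n_gt0 => // m _; nia.
have Lc : L%:Z < c + (K * n.+1)%N%:Z.
  by rewrite /c /p /K; case: n n_gt0 => // m _; nia.
have wK : block y c K = 0.
  apply/matrixP => i j; rewrite !mxE y0// negb_and; apply/orP; right.
  by rewrite -ltNge; lia.
have [z [z1 zM]] := block_chain_form a n_gt0 wK.
exists z; rewrite z1 zM -sqnorm_sum_blocks -edge_sum_blocks -/c.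
split.
  rewrite (@window_sum _ (fun k => y k * Num.conj (y k))); last first.
    move=> k; apply: contraNT => kout; rewrite y0 ?mul0r//; lia.
  rewrite -(@window_sum _ _ (- L%:Z) L.*2.+1); last first.
    move=> k; apply: contraNT => kout; rewrite y0 ?mul0r//; lia.
  apply: eq_bigr => i _; rewrite /y addrC ifT//.
  by have := ltn_ord i; lia.
rewrite (@window_sum _ (edge_form a y)); last first.
  move=> k; apply: contraNT => kout; rewrite /edge_form.
  have [kL|kL] := boolP ((- L%:Z <= k) && (k <= L%:Z)); last first.
    by rewrite (y0 k kL) rmorph0 mulr0 mul0r mulr0 addr0.
  by lia.
(* The coupling at [k = L] vanishes because [y (L + 1) = 0]; hence [2L] couplings and not
   [2L + 1]. *)
rewrite -(@window_sum _ _ (- L%:Z) L.*2); last first.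
  move=> k; apply: contraNT => kout; rewrite /edge_form.
  have [kL|kL] := boolP ((- L%:Z <= k) && (k <= L%:Z)); last first.
    by rewrite (y0 k kL) rmorph0 mulr0 mul0r mulr0 addr0.
  have -> : y (k + 1) = 0 by apply: y0; lia.
  by rewrite rmorph0 mul0r !mulr0 addr0.
apply: eq_bigr => i _; rewrite /edge_form /y [- _ + _]addrC !ifT//.
  by have := ltn_ord i; lia.
by have := ltn_ord i; lia.
Qed.

(** The form of a truncation of [x], divided by its squared norm [nL L], lies in the closed set on
    the right. These quotients converge to the value at [x], as [nL] tends to 1. *)
Lemma numrange_tridiag_sub (ba : bounded_seq a) :
  numrange (@ell2_ip R) (tridiag_op ba) `<=`
  numrange (@cV_ip R (n.+1 + n.+1))
    (mulmx (block_mx (corner_mx n a 1) 0 0 (corner_mx n a (-1)))).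
Proof.
move=> _ [x /= x1 <-].
have {}x1 : ell2_ip x x = 1 by rewrite -[LHS]sqrtCK x1 expr1n.
have nc := @ell2_ip_cvg _ x x; rewrite x1 in nc.
have qc := @ell2_ip_tridiag_cvg _ a ba x.
set nL := symsum _ in nc; set q := (fun L : nat => _) in qc.
have rc : (fun L => q L * (nL L)^-1 : R[i]^o) @ \oo -->
    (ell2_ip (tridiag_op ba x) x : R[i]^o).
  rewrite -[ell2_ip (tridiag_op ba x) x]mulr1 -invr1.
  exact: cvgC_div (oner_neq0 _) qc nc.
apply: (@closed_cvg nat R[i]^o \oo _ (fun L => q L / nL L) _
  (@numrange_closed R _ _) _ _ rc).
have n0 : \forall L \near \oo, nL L != 0.
  exact: (cvgr_neq0 (1 : R[i]^o) nc (oner_neq0 _)).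
near=> L.
have nL0 : nL L != 0 by near: L.
have [z [z1 zM]] := truncated_form x L.
have np : 0 <= (nL L)^-1 by rewrite invr_ge0 -[nL L]z1 cV_ip_ge0.
have [z' [z'1 z'M]] := quadratic_form_scale
  (block_mx (corner_mx n a 1) 0 0 (corner_mx n a (-1))) z np.
apply/numrangeP; exists z'; rewrite z'1 z'M z1 zM; split; first exact: mulVf.
by rewrite mulrC.
Unshelve. all: by end_near. Qed.

End Blocks.

(** * Chains of reflected blocks *)

Section Chains.
Variables (R : realType) (n : nat) (a : int -> R).
Hypothesis n_gt0 : (0 < n)%N.
Hypothesis a_periodic : forall k : int, a k = a (k + n.+1%:Z).
Hypothesis palindrome : rev (period_word n a) = period_word n a.
Implicit Types (s : R[i]) (w : 'cV[R[i]]_n.+1).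

Lemma size_period_word : size (period_word n a) = n.
Proof. by rewrite size_rcons size_map size_iota prednK. Qed.

(** By periodicity the last letter [a_0] is [a_(n+1)], so one formula covers the whole word. *)
Lemma nth_period_word i : (i < n)%N -> nth 0 (period_word n a) i = a i.+2%:Z.
Proof.
move=> ni; rewrite nth_rcons size_map size_iota.
have [ilt|ige] := ltnP i n.-1.
  by rewrite (nth_map 0%N) ?size_iota// nth_iota.
have -> : i = n.-1 by lia.
by rewrite eqxx a_periodic add0r; congr (a _); lia.
Qed.

Lemma palindrome_entry i : (i < n)%N -> a i.+2%:Z = a (n.-1 - i).+2%:Z.
Proof.
move=> ni; rewrite -!nth_period_word//; last by lia.
rewrite -[in LHS]palindrome nth_rev ?size_period_word//; congr nth; lia.
Qed.

(** Supplies the phase that makes the first entry of the reflected block equal to [s] times the last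
    entry [p] of the original. *)
Lemma conj_phase (p s : R[i]) : s \is Num.real -> s * s = 1 ->
  exists c : R[i], c * Num.conj c = 1 /\ c * Num.conj p = s * p.
Proof.
move=> /CrealP sr ss; have [->|p0] := eqVneq p 0.
  by exists 1; rewrite rmorph1 rmorph0 !mulr0 mulr1.
have p0' : Num.conj p != 0 by rewrite conjC_eq0.
exists (s * p / Num.conj p); split; last by rewrite divfK.
rewrite rmorphM rmorphM /= fmorphV /= conjCK sr.
transitivity (s * s * (p / p) * (Num.conj p / Num.conj p)); first by ring.
by rewrite ss !divff// !mulr1.
Qed.

(* Reversing a block transposes its form, since the entries above the diagonal
   stay 1; complex conjugation undoes the transposition. *)
Lemma reflected_block s w : s \is Num.real -> s * s = 1 ->
  exists w', [/\ cV_ip w' w' = cV_ip w w,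
    cV_ip (corner_mx n a s *m w') w' = cV_ip (corner_mx n a s *m w) w &
    w' ord0 0 = s * w ord_max 0].
Proof.
move=> sr ss; have [c [cc cf]] := conj_phase (w ord_max 0) sr ss.
pose f k := w (inord k) 0.
have wE : w = colf n f := colfK w.
pose g k := c * Num.conj (f (n - k)%N).
(* The phase cancels; conjugation and reversal together send the coupling of [i] and [i + 1] to that
   of [n - i - 1] and [n - i] with the same orientation. *)
have gg i j : g i * Num.conj (g j) = f (n - j)%N * Num.conj (f (n - i)%N).
  rewrite /g rmorphM /= conjCK.
  transitivity (c * Num.conj c * (f (n - j)%N * Num.conj (f (n - i)%N))); first by ring.
  by rewrite cc mul1r.
exists (colf n g); rewrite wE; split.
- rewrite !cV_ip_colf (reindex_inj rev_ord_inj) /=; apply: eq_bigr => i _.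
  rewrite gg; have -> : (n - (n.+1 - i.+1))%N = i by have := ltn_ord i; lia.
  by [].
- rewrite !corner_formE// !gg subn0 subnn addrC [in RHS]addrC.
  congr (_ + s * _); last by rewrite addrC.
  rewrite (reindex_inj rev_ord_inj) /=; apply: eq_bigr => i _; rewrite !gg.
  have in_ := ltn_ord i.
  have -> : (n - (n - i.+1).+1 = i)%N by lia.
  have -> : (n - (n - i.+1) = i.+1)%N by lia.
  congr (_ + real_complex R _ * _).
  have -> : (n - i.+1)%N = (n.-1 - i)%N by lia.
  by rewrite -palindrome_entry.
- rewrite !mxE /g /= subn0.
  suff -> : f n = w ord_max 0 by [].
  by congr (w _ _); apply/val_inj; rewrite /= inordK.
Qed.

Lemma reflected_chain s w : s \is Num.real -> s * s = 1 ->
  exists u : nat -> 'cV[R[i]]_n.+1, forall b,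
  [/\ cV_ip (u b) (u b) = cV_ip w w,
    cV_ip (corner_mx n a s *m u b) (u b) = cV_ip (corner_mx n a s *m w) w &
    u b.+1 ord0 0 = s * u b ord_max 0].
Proof.
move=> sr ss.
have /choice[g gP] := fun w => reflected_block w sr ss.
exists (fun b => iter b g w) => b.
suff [h1 h2] : cV_ip (iter b g w) (iter b g w) = cV_ip w w /\
    cV_ip (corner_mx n a s *m iter b g w) (iter b g w) =
    cV_ip (corner_mx n a s *m w) w.
  by split=> //; rewrite iterS; have [] := gP (iter b g w).
elim: b => [|b [h1 h2]] //; rewrite iterS.
by have [-> -> _] := gP (iter b g w).
Qed.

(** If [p] is the last entry of [u b], its coupling to the next block is [2 s |p|^2], while the
    corners account for [s |p|^2] and [s] times the square of the first entry. As [|p|^2] is also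
    the square of the next first entry, the differences telescope. *)
Lemma reflected_chain_sum s (u : nat -> 'cV[R[i]]_n.+1) (e : R[i]) M :
  s \is Num.real -> s * s = 1 ->
  (forall b, cV_ip (corner_mx n a s *m u b) (u b) = e) ->
  (forall b, u b.+1 ord0 0 = s * u b ord_max 0) ->
  \sum_(b < M) chain_term a (u b) (u b.+1) = M%:R * e +
    s * (u M ord0 0 * Num.conj (u M ord0 0) - u 0%N ord0 0 * Num.conj (u 0%N ord0 0)).
Proof.
move=> /CrealP sr ss ue us; elim: M => [|M IH].
  by rewrite big_ord0 mul0r subrr mulr0 addr0.
rewrite big_ord_recr /= IH -(ue M) (corner_form_shift a n_gt0 s).
rewrite /chain_term /boundary_form us rmorphM /= sr -[M.+1]addn1 natrD.
set p := u M ord_max 0; set q := u M ord0 0; set t := u 0%N ord0 0.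
have -> : s * p * (s * Num.conj p) = s * s * (p * Num.conj p) by ring.
by rewrite ss; ring.
Qed.

Lemma cV_entry_le w i : w i 0 * Num.conj (w i 0) <= cV_ip w w.
Proof.
rewrite /cV_ip (bigD1 i)//= lerDl; apply: sumr_ge0 => j _; exact: mul_conjC_ge0.
Qed.

(** Couplings within each half are accounted for exactly. Errors arise only at the two outer ends
    and at the junction, so their bound does not depend on [M]. *)
Lemma double_chain (u0 v0 : 'cV[R[i]]_n.+1) (M : nat) :
  let E := cV_ip (corner_mx n a 1 *m u0) u0 + cV_ip (corner_mx n a (-1) *m v0) v0 in
  let U := cV_ip u0 u0 + cV_ip v0 v0 in
  exists w : nat -> 'cV[R[i]]_n.+1,
  [/\ forall b, (M.+1 + M.+1 <= b)%N -> w b = 0,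
   \sum_(b < M.+1 + M.+1) cV_ip (w b) (w b) = M.+1%:R * U &
   `|\sum_(b < M.+1 + M.+1) chain_term a (w b) (w b.+1) - M.+1%:R * E| <= 3 * U].
Proof.
move=> E U.
have m1r : (-1 : R[i]) \is Num.real by rewrite realN real1.
have m11 : -1 * -1 = 1 :> R[i] by rewrite mulrNN mulr1.
have [u uP] := reflected_chain u0 (real1 _) (mulr1 1).
have [v vP] := reflected_chain v0 m1r m11.
pose w b := if (b < M.+1)%N then u b else
  if (b < M.+1 + M.+1)%N then v (b - M.+1)%N else 0.
have w1 b : (b < M.+1)%N -> w b = u b by rewrite /w => ->.
have w2 b : (b < M.+1)%N -> w (M.+1 + b)%N = v b.
  by move=> bM; rewrite /w ifF ?ifT ?addKn//; lia.
have w3 b : (M.+1 + M.+1 <= b)%N -> w b = 0.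
  by move=> bM; rewrite /w !ifF//; lia.
exists w; split=> //.
  rewrite big_split_ord /= mulrDr; congr (_ + _).
    rewrite (eq_bigr (fun=> cV_ip u0 u0)) => [|b _].
      by rewrite sumr_const card_ord mulr_natl.
    by rewrite w1//; have [] := uP b.
  rewrite (eq_bigr (fun=> cV_ip v0 v0)) => [|b _].
    by rewrite sumr_const card_ord mulr_natl.
  by rewrite w2//; have [] := vP b.
have uE b : cV_ip (corner_mx n a 1 *m u b) (u b) = cV_ip (corner_mx n a 1 *m u0) u0.
  by have [] := uP b.
have vE b : cV_ip (corner_mx n a (-1) *m v b) (v b) = cV_ip (corner_mx n a (-1) *m v0) v0.
  by have [] := vP b.
have us b : u b.+1 ord0 0 = 1 * u b ord_max 0 by have [] := uP b.
have vs b : v b.+1 ord0 0 = -1 * v b ord_max 0 by have [] := vP b.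
rewrite big_split_ord !big_ord_recr /=.
rewrite (eq_bigr (fun b : 'I_M => chain_term a (u b) (u b.+1))); last first.
  by move=> b _; have := ltn_ord b => bM; rewrite !w1//; lia.
rewrite [X in _ + (X + _)](eq_bigr (fun b : 'I_M => chain_term a (v b) (v b.+1))); last first.
  by move=> b _; have := ltn_ord b => bM; rewrite -addnS !w2//; lia.
rewrite (reflected_chain_sum M (real1 _) (mulr1 1) uE us).
rewrite (reflected_chain_sum M m1r m11 vE vs).
have wM1 : w M.+1 = v 0%N by rewrite -(w2 0%N)// addn0.
rewrite w1// wM1 w2// w3 ?addnS// /chain_term.
have uA := uE M; rewrite (corner_form_shift a n_gt0 1) in uA.
have vA := vE M; rewrite (corner_form_shift a n_gt0 (-1)) in vA.
have uN b : cV_ip (u b) (u b) = cV_ip u0 u0 by have [] := uP b.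
have vN b : cV_ip (v b) (v b) = cV_ip v0 v0 by have [] := vP b.
have [b1 b2] := boundary_form_le (u M ord_max 0) (v 0%N ord0 0).
have p1 := cV_entry_le (u 0%N) ord0; have p2 := cV_entry_le (u M) ord_max.
have p3 := cV_entry_le (v 0%N) ord0; have p4 := cV_entry_le (v M) ord_max.
rewrite uN in p1; rewrite uN in p2; rewrite vN in p3; rewrite vN in p4.
rewrite /E -uA -vA mxE.
set F0 := u 0%N ord0 0 * _ in p1 *; set L1 := u M ord_max 0 * _ in p2 b1 b2 *.
set G0 := v 0%N ord0 0 * _ in p3 b1 b2 *; set K1 := v M ord_max 0 * _ in p4 *.
set bd := boundary_form (u M ord_max 0) _ in b1 b2 *.
set X := (X in `|X| <= _).
(* What is left is the coupling at the junction and the corner terms at the four ends of the two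
   halves. *)
have -> : X = bd + (G0 + K1) - (F0 + L1).
  rewrite /X /boundary_form rmorph0 mulr0 mul0r -[M.+1]addn1 natrD; ring.
have bdr : `|bd| <= L1 + G0.
  rewrite real_ler_norml ?b1 ?b2// CrealE /bd /boundary_form rmorphD !rmorphM /=.
  by rewrite !conjCK addrC [X in _ + X]mulrC [X in X + _]mulrC.
have -> : 3 * U = cV_ip u0 u0 + cV_ip v0 v0 + (cV_ip v0 v0 + cV_ip v0 v0) +
    (cV_ip u0 u0 + cV_ip u0 u0) by rewrite /U; ring.
apply: le_trans (ler_normB _ _) (lerD _ _).
  apply: le_trans (ler_normD _ _) (lerD _ _).
    by apply: le_trans bdr _; exact: lerD.
  by rewrite ger0_norm ?addr_ge0 ?mul_conjC_ge0//; exact: lerD.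
by rewrite ger0_norm ?addr_ge0 ?mul_conjC_ge0//; exact: lerD.
Qed.

End Chains.

(** * Finitely supported vectors in the sequence space *)

Section FiniteSupport.
Variables (R : realType) (y : int -> R[i]) (c : int) (m : nat).
Hypothesis ysupp : forall k, y k != 0 -> c <= k < c + m%:Z.

Lemma finite_support_square_summable : y \in @square_summable R.
Proof.
apply/asboolP; rewrite /sqnorm.
pose r := [seq c + i%:Z | i <- iota 0 m].
have -> : (\esum_(k in [set: int]) (normc (y k) ^+ 2)%:E =
    \esum_(k in [set` r]) (normc (y k) ^+ 2)%:E)%E.
  rewrite [RHS]esum_mkcond; apply: eq_esum => k _.
  case: ifPn => // /negP kr; have [->|yk] := eqVneq (y k) 0.
    by rewrite (@normc0 R) expr0n.
  case: kr; apply/mem_set/mapP; have /andP[ck kc] := ysupp yk.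
  by exists `|k - c|%N; rewrite ?mem_iota; lia.
rewrite esum_fset; [|exact: finite_seq|by move=> k _; rewrite lee_fin sqr_ge0].
rewrite -fsbig_seq; last by rewrite map_inj_uniq ?iota_uniq// => i j /addrI [].
by rewrite sumEFin ltry.
Qed.

Definition finite_support_ell2 : ell2 R := Ell2 finite_support_square_summable.

(** The sums are constant once the window contains the support. The parameter [p] is 1 for sums over
    sites and 0 for sums over couplings. *)
Lemma window_sum_near (f : int -> R[i]) (p : nat) :
  (forall k, f k != 0 -> c <= k < c + m%:Z) ->
  (fun L : nat => \sum_(i < L.*2 + p) f (i%:Z - L%:Z) : R[i]^o) @ \oo -->
  (\sum_(i < m) f (c + i%:Z) : R[i]^o).
Proof.
move=> fs; apply: cvg_near_cst.
near=> L.
have Lbig : (`|c|%N + m <= L)%N by near: L; exact: nbhs_infty_ge.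
rewrite (window_sum fs) -(@window_sum _ f (- L%:Z) (L.*2 + p)).
  by apply: eq_bigr => i _; rewrite addrC.
by move=> k /fs/andP[ck kc]; lia.
Unshelve. all: by end_near. Qed.

Lemma ell2_ip_finite_support :
  ell2_ip finite_support_ell2 finite_support_ell2 =
  \sum_(i < m) y (c + i%:Z) * Num.conj (y (c + i%:Z)).
Proof.
have h1 := @ell2_ip_cvg _ finite_support_ell2 finite_support_ell2.
have h2 : (symsum (fun k => y k * Num.conj (y k)) : nat -> R[i]^o) @ \oo -->
    (\sum_(i < m) y (c + i%:Z) * Num.conj (y (c + i%:Z)) : R[i]^o).
  rewrite (_ : symsum _ = fun L : nat => \sum_(i < L.*2 + 1)
    (fun k => y k * Num.conj (y k)) (i%:Z - L%:Z)); last first.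
    by apply/funext => L; rewrite addn1.
  apply: (@window_sum_near (fun k => y k * Num.conj (y k)) 1) => k yk; apply: ysupp.
  by apply: contraNneq yk => ->; rewrite mul0r.
exact: (cvg_unique (@norm_hausdorff _ R[i]^o) h1 h2).
Qed.

Lemma ell2_ip_tridiag_finite_support (a : int -> R) (ba : bounded_seq a) :
  ell2_ip (tridiag_op ba finite_support_ell2) finite_support_ell2 =
  \sum_(i < m) edge_form a y (c + i%:Z).
Proof.
have h1 := @ell2_ip_tridiag_cvg _ a ba finite_support_ell2.
have h2 := @window_sum_near (edge_form a y) 0.
apply: (cvg_unique (@norm_hausdorff _ R[i]^o) h1).
rewrite (_ : (fun L : nat => _) = fun L : nat => \sum_(i < L.*2 + 0)
  edge_form a y (i%:Z - L%:Z)); last by apply/funext => L; rewrite addn0.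
apply: h2 => k; apply: contraNT => kout; rewrite /edge_form.
have [->|yk] := eqVneq (y k) 0; first by rewrite rmorph0 !mulr0 mul0r mulr0 addr0.
by have := ysupp yk; lia.
Qed.

End FiniteSupport.

(** * Approximation of the values of the block diagonal matrix *)

Section Closure.
Variables (R : realType) (n : nat) (a : int -> R).
Hypothesis n_gt0 : (0 < n)%N.
Hypothesis a_periodic : forall k : int, a k = a (k + n.+1%:Z).
Hypothesis a1 : a 1 = 1.
Hypothesis palindrome : rev (period_word n a) = period_word n a.

Lemma concat_blocks (w : nat -> 'cV[R[i]]_n.+1) K (ba : bounded_seq a) :
  (forall b, (K <= b)%N -> w b = 0) ->
  exists x : ell2 R,
    ell2_ip x x = \sum_(b < K) cV_ip (w b) (w b) /\
    ell2_ip (tridiag_op ba x) x = \sum_(b < K) chain_term a (w b) (w b.+1).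
Proof.
move=> w0.
(* The blocks are laid out from site 2 rightwards, so that the cuts fall on couplings of weight
   [a_1]; quotient and remainder give the block and the entry. *)
pose y (k : int) : R[i] := if 2 <= k
  then w (`|k - 2| %/ n.+1)%N (inord (`|k - 2| %% n.+1)%N) 0 else 0.
pose c : int := 2 + 0 * n.+1%:Z.
have c2 : c = 2 by rewrite /c mul0r addr0.
have ysupp k : y k != 0 -> c <= k < c + (K * n.+1)%N%:Z.
  rewrite c2 /y; case: ifP => [k2|_]; last by rewrite eqxx.
  apply: contraNT => kout; rewrite w0 ?mxE// leq_divRL//; lia.
have yw b : block n y c b = w b.
  apply/matrixP => i j; rewrite ord1 [LHS]mxE c2 /y.
  have -> : (2 <= 2 + (b * n.+1 + i)%N%:Z :> int) = true by lia.
  have -> : absz (2 + (b * n.+1 + i)%N%:Z - 2)%R = (b * n.+1 + i)%N by lia.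
  by rewrite divnMDl// modnMDl divn_small// modn_small// addn0 inord_val.
exists (finite_support_ell2 ysupp).
rewrite ell2_ip_finite_support ell2_ip_tridiag_finite_support.
rewrite sqnorm_sum_blocks (edge_sum_blocks n_gt0 a_periodic a1) -/c.
by split; apply: eq_bigr => b _; rewrite !yw.
Qed.

Lemma numrange_block_sub_closure (ba : bounded_seq a) :
  numrange (@cV_ip R (n.+1 + n.+1))
    (mulmx (block_mx (corner_mx n a 1) 0 0 (corner_mx n a (-1)))) `<=`
  closure (numrange (@ell2_ip R) (tridiag_op ba) : set R[i]^o).
Proof.
move=> e /numrangeP[z]; rewrite -(vsubmxK z).
set u := usubmx z; set v := dsubmx z.
rewrite mul_block_diag_col !cV_ip_col_mx => -[uv1 eE].
have approx (M : nat) : exists q : R[i],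
    numrange (@ell2_ip R) (tridiag_op ba) q /\
    normc (q - e) <= 3 * harmonic M.
  (* Dividing the squared norms of [u] and [v] by [M + 1] makes the double chain a unit vector and
     its error at most [3 / (M + 1)]. *)
  have M0 : 0 <= (M.+1%:R : R[i])^-1 by rewrite invr_ge0.
  have Mn0 : (M.+1%:R : R[i]) != 0 by rewrite pnatr_eq0.
  have [u' [u'1 u'A]] := quadratic_form_scale (corner_mx n a 1) u M0.
  have [v' [v'1 v'A]] := quadratic_form_scale (corner_mx n a (-1)) v M0.
  have [w [w0 w1 wM]] := double_chain n_gt0 a_periodic palindrome u' v' M.
  rewrite u'1 v'1 -mulrDr uv1 mulr1 in w1 wM.
  rewrite mulfV// in w1; rewrite u'A v'A -mulrDr eE mulVKf// in wM.
  have [x [x1 xM]] := concat_blocks ba w0.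
  exists (ell2_ip (tridiag_op ba x) x); split.
    by exists x => //=; rewrite x1 w1 sqrtC1.
  rewrite -lecR -normCE xM (le_trans wM)// le_eqVlt; apply/orP; left; apply/eqP.
  by rewrite /harmonic rmorphM fmorphV !rmorph_nat.
have /choice[q qP] := approx.
have q0 : (fun M => q M - e : R[i]^o) @ \oo --> (0 : R[i]^o).
  apply: (@squeeze_cvgC0 _ _ (fun M => 3 * harmonic M)) => [M|].
    by have [] := qP M.
  by rewrite -(mulr0 3); exact: cvgMl_tmp (@cvg_harmonic R).
have qe : (q : nat -> R[i]^o) @ \oo --> (e : R[i]^o) by apply/subr_cvg0.
apply: (@closed_cvg nat R[i]^o \oo _ q _ (@closed_closure _ _) _ _ qe).
by apply: nearW => M; apply: subset_closure; have [] := qP M.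
Qed.

End Closure.

Unset Implicit Arguments.
Set Strict Implicit.
Set Printing Implicit Defensive.

Theorem mainTheorem2 (R : realType) (n : nat) (a : int -> R)
    (n_gt0 : (0 < n)%N)
    (a_periodic : forall k : int, a k = a (k + n.+1%:Z))
    (a1 : a 1 = 1)
    (palindrome : rev (period_word n a) = period_word n a) :
  closure (numrange (@ell2_ip R) (tridiag_op (periodic_bounded a_periodic))
             : set R[i]^o) =
  conv_hull (numrange (@cV_ip R n.+1) (mulmx (corner_mx n a 1)) `|`
             numrange (@cV_ip R n.+1) (mulmx (corner_mx n a (-1)))).
Proof.
rewrite conv_hull_numrangeU; apply/seteqP; split; last first.
  exact: numrange_block_sub_closure.
(* The closure is the smallest closed superset, and the block diagonal range is closed. *)
rewrite closureE; apply: smallest_sub; first exact: numrange_closed.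
exact: numrange_tridiag_sub.
Qed.
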